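(* If the fusion rule $\mathcal R$ is primitive, then the dynamical system $(X_{\mathcal R},G)$ is minimal, i.e. $X_{\mathcal R}$ is the $G$-orbit closure of each of its elements.
   Context: $G$ is a closed subgroup of the Euclidean group $E(d)$ containing a full rank lattice of translations. A prototile is a labelled closed topological disk in $\mathbb R^d$; $\mathcal P_0$ is a finite set of prototiles. A tile is an image $g(p)$, $g\in G$, of a prototile (label carried along). A patch is a connected finite union of tiles overlapping only on boundaries; two patches are copies of one another if an element of $G$ takes one to the other. A tiling is a collection of tiles covering $\mathbb R^d$ and overlapping only on boundaries. A fusion rule is $\mathcal R=\{\mathcal P_n\}_{n\ge0}$, where $\mathcal P_n=\{P_n(1),\ldots,P_n(j_n)\}$ is a finite set of patches ($n$-supertiles) and each $P_n(j)$, $n\ge1$, is a union of copies of elements of $\mathcal P_{n-1}$ overlapping only on boundaries (a preferred decomposition is fixed). A patch is admitted by $\mathcal R$ if a copy of it is contained in some $P_n(j)$. $X_{\mathcal R}$ is the set of all tilings of $\mathbb R^d$ all of whose patches are admitted by $\mathcal R$. Standing assumptions: $X_{\mathcal R}$ is nonempty and has finite local complexity (finitely many connected two-tile patches up to $G$). Topology: two tilings $\mathbf T_1,\mathbf T_2$ are $\epsilon$-close if there are $g_1,g_2\in G$ of size at most $\epsilon$ such that $g_1(\mathbf T_1)$ and $g_2(\mathbf T_2)$ agree exactly on the ball of radius $1/\epsilon$ around the origin. $\mathcal R$ is primitive if for each $n\ge0$ there is $N$ such that every $N$-supertile contains (in its decomposition into $n$-supertiles) a copy of every $n$-supertile. 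*)

(* Defs.v *)
From HB Require Import structures.
From mathcomp Require Import all_boot all_order all_algebra.
From mathcomp Require Import all_classical all_reals all_analysis.
Import Order.TTheory GRing.Theory Num.Theory.
Import numFieldNormedType.Exports.

Set Implicit Arguments.
Unset Strict Implicit.
Unset Printing Implicit Defensive.

Local Open Scope classical_set_scope.
Local Open Scope ring_scope.

Section Euclidean.
Context {R : realType}.

(* The library norm on matrices is the sup norm of the entries; this is the
   Euclidean norm on row vectors and the Frobenius norm on square matrices. *)
Definition eucl_norm m n (M : 'M[R]_(m, n)) : R :=
  Num.sqrt (\sum_i \sum_j M i j ^+ 2).

Definition closed_ball0 d (r : R) : set 'rV[R]_d :=
  [set x | eucl_norm x <= r].

(* Homeomorphic to the closed unit ball, for the subspace topologies. *)
Definition closed_disk d (A : set 'rV[R]_d) : Prop :=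
  exists h k : 'rV[R]_d -> 'rV[R]_d,
    [/\ {within closed_ball0 1, continuous h},
        {within A, continuous k},
        h @` closed_ball0 1 = A,
        {in closed_ball0 1, cancel h k} &
        {in A, cancel k h}].

Definition boundary (T : topologicalType) (A : set T) : set T :=
  closure A `\` A°.

Definition overlap_on_boundary (T : topologicalType) (A B : set T) : Prop :=
  A `&` B `<=` boundary A `&` boundary B.

(* A pair (A, v) stands for the affine map x |-> x A + v on row vectors. *)
Definition motion d : Type := ('M[R]_d * 'rV[R]_d)%type.

Definition euclidean_group d : set (motion d) :=
  [set g | g.1 *m g.1^T = 1%:M].

Definition mapply d (g : motion d) (x : 'rV[R]_d) : 'rV[R]_d :=
  x *m g.1 + g.2.

Definition mid d : motion d := (1%:M, 0).

(* Composition: [mmul g h] acts as [mapply g \o mapply h]. *)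
Definition mmul d (g h : motion d) : motion d :=
  (h.1 *m g.1, h.2 *m g.1 + g.2).

Definition minv d (g : motion d) : motion d := (g.1^T, - (g.2 *m g.1^T)).

Definition msize d (g : motion d) : R :=
  Num.max (eucl_norm (g.1 - 1%:M)) (eucl_norm g.2).

Definition euclidean_subgroup d (G : set (motion d)) : Prop :=
  [/\ G `<=` @euclidean_group d, G (mid d),
      forall g h, G g -> G h -> G (mmul g h) &
      forall g, G g -> G (minv g)].

(* The rows of B are a basis of the lattice. *)
Definition contains_full_lattice d (G : set (motion d)) : Prop :=
  exists2 B : 'M[R]_d, B \in unitmx &
    forall z : 'rV[int]_d, G (1%:M, map_mx intr z *m B).

(* The topology of E(d) is the one it inherits from 'M_d * 'rV_d, in which
   E(d) is closed. *)
Definition admissible_group d (G : set (motion d)) : Prop :=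
  [/\ euclidean_subgroup G, closed G & contains_full_lattice G].

Lemma mapply_id d (x : 'rV[R]_d) : mapply (mid d) x = x.
Proof. by rewrite /mapply mulmx1 addr0. Qed.

Lemma mapply_mul d (g h : motion d) x :
  mapply (mmul g h) x = mapply g (mapply h x).
Proof. by rewrite /mapply mulmxA mulmxDl addrA. Qed.

Lemma mapply_inv d (g : motion d) x :
  euclidean_group g -> mapply (minv g) (mapply g x) = x.
Proof.
by move=> gE; rewrite /mapply mulmxDl -mulmxA gE mulmx1 addrK.
Qed.

End Euclidean.
Arguments motion : clear implicits.
Arguments euclidean_group : clear implicits.

Section Tiles.
Context {R : realType} {d : nat} {L : Type}.

(* Support and label. *)
Definition tile : Type := (set 'rV[R]_d * L)%type.

Definition tact (g : motion R d) (t : tile) : tile := (mapply g @` t.1, t.2).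

(* The motion g applied to a patch, or to a whole tiling. *)
Definition pact (g : motion R d) (P : set tile) : set tile := tact g @` P.

Definition support (P : set tile) : set 'rV[R]_d := \bigcup_(t in P) t.1.

Definition non_overlapping (P : set tile) : Prop :=
  forall t u, P t -> P u -> t <> u -> overlap_on_boundary t.1 u.1.

Definition is_tile (G : set (motion R d)) n (p : 'I_n -> tile) : set tile :=
  [set t | exists i, exists2 g, G g & t = tact g (p i)].

Definition patch (G : set (motion R d)) n (p : 'I_n -> tile) (P : set tile) :
    Prop :=
  [/\ finite_set P, P !=set0, P `<=` is_tile G p, non_overlapping P &
      connected (support P)].

Definition copy (G : set (motion R d)) (P Q : set tile) : Prop :=
  exists2 g, G g & Q = pact g P.

Definition tiling (G : set (motion R d)) n (p : 'I_n -> tile) (T : set tile) :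
    Prop :=
  [/\ T `<=` is_tile G p, support T = setT & non_overlapping T].

Definition tiles_meeting (T : set tile) (B : set 'rV[R]_d) : set tile :=
  [set t | T t /\ t.1 `&` B !=set0].

Definition agree_on (B : set 'rV[R]_d) (T U : set tile) : Prop :=
  tiles_meeting T B = tiles_meeting U B.

Definition eps_close (G : set (motion R d)) (e : R) (T U : set tile) : Prop :=
  exists g h, [/\ G g, G h, msize g <= e, msize h <= e &
                  agree_on (closed_ball0 e^-1) (pact g T) (pact h U)].

End Tiles.
Arguments tile : clear implicits.

(* [dec i] is the preferred decomposition of the (n.+1)-supertile i: the piece
   a is the copy [pact (dec i a).1 (supertile (dec i a).2)] of an
   n-supertile. *)
Record fusion_rule (R : realType) (d : nat) (L : Type)
    (G : set (motion R d)) := FusionRule {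
  num : nat -> nat;
  prototile : 'I_(num 0) -> tile R d L;
  supertile : forall n, 'I_(num n) -> set (tile R d L);
  dec_size : forall n, 'I_(num n.+1) -> nat;
  dec : forall n (i : 'I_(num n.+1)),
    'I_(dec_size i) -> motion R d * 'I_(num n);
  prototile_disk : forall i, closed_disk (prototile i).1;
  supertile_patch : forall n (i : 'I_(num n)), patch G prototile (supertile i);
  supertile0 : forall i : 'I_(num 0), supertile i = [set prototile i];
  dec_group : forall n (i : 'I_(num n.+1)) a, G (@dec n i a).1;
  dec_cover : forall n (i : 'I_(num n.+1)),
    supertile i = \bigcup_a pact (@dec n i a).1 (supertile (@dec n i a).2);
  dec_overlap : forall n (i : 'I_(num n.+1)) (a b : 'I_(dec_size i)), a <> b ->
    overlap_on_boundary
      (support (pact (@dec n i a).1 (supertile (@dec n i a).2)))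
      (support (pact (@dec n i b).1 (supertile (@dec n i b).2)))
}.

Section Fusion.
Context {R : realType} {d : nat} {L : Type} {G : set (motion R d)}.
Variable F : fusion_rule L G.

(* The decomposition of an (m + n)-supertile into n-supertiles obtained by
   iterating [dec]; (g, k) stands for the piece [pact g (supertile k)]. *)
Fixpoint pieces m n : 'I_(num F (m + n)) -> set (motion R d * 'I_(num F n)) :=
  match m with
  | 0 => fun i => [set (mid d, i)]
  | m'.+1 => fun i =>
      \bigcup_(a : 'I_(dec_size i))
        [set (mmul (dec a).1 c.1, c.2) | c in @pieces m' n (dec a).2]
  end.

Definition admitted (P : set (tile R d L)) : Prop :=
  exists n (i : 'I_(num F n)), exists2 g, G g & pact g P `<=` supertile i.

Definition tiling_space : set (set (tile R d L)) :=
  [set T | tiling G (@prototile _ _ _ _ F) T /\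
     forall P, patch G (@prototile _ _ _ _ F) P -> P `<=` T -> admitted P].

Definition two_tile_patch (P : set (tile R d L)) : Prop :=
  patch G (@prototile _ _ _ _ F) P /\
  exists t u, t <> u /\ P = [set t; u].

Definition finite_local_complexity : Prop :=
  exists2 Q : set (set (tile R d L)), finite_set Q &
    forall T P, tiling_space T -> two_tile_patch P -> P `<=` T ->
      exists2 P0, Q P0 & copy G P0 P.

Definition primitive : Prop :=
  forall n, exists m, forall (i : 'I_(num F (m + n))) (k : 'I_(num F n)),
    exists2 c, pieces i c & copy G (supertile k) (pact c.1 (supertile c.2)).

(* Closure of the G-orbit of T in the space of all tilings by the
   prototiles. *)
Definition orbit_closure (T : set (tile R d L)) : set (set (tile R d L)) :=
  [set U | tiling G (@prototile _ _ _ _ F) U /\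
     forall e : R, 0 < e -> exists2 g, G g & eps_close G e (pact g T) U].

Definition minimal : Prop :=
  forall T, tiling_space T -> orbit_closure T = tiling_space.

End Fusion.

(* Main.v *)
From Pilot Require Import Defs.
From HB Require Import structures.
From mathcomp Require Import all_boot all_order all_algebra.
From mathcomp Require Import fingroup perm zify ring lra.
From mathcomp Require Import all_classical all_reals all_analysis.
Import Order.TTheory GRing.Theory Num.Theory.
Import numFieldNormedType.Exports.
(* [closed_ball0], [patch] and [support] also name notions of the libraries. *)
Import Pilot.Defs.

Set Implicit Arguments.
Unset Strict Implicit.
Unset Printing Implicit Defensive.

Local Open Scope classical_set_scope.
Local Open Scope ring_scope.

(** Let T and U be two elements of the tiling space. The tiles of U that meet a large
    ball form a patch, so a copy of it lies in a supertile of some level n. By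
    primitivity every supertile of some level m + n contains a copy of that supertile,
    so it is enough that T contains a whole supertile of each level
    ([tiling_contains_supertile]). The tiles of T that meet a ball much larger than
    all supertiles of level at most M form an admitted patch; the supertile holding it
    has level at least M, and the level-M piece of it that contains the image of the
    centre is swallowed by the patch. Hence a motion of T contains the chosen patch of
    U, and then it has no other tile near the ball: T accumulates on U
    ([sub_orbit_closure]). The converse is a finiteness argument: a patch of a limit of
    moved copies of T is, up to a motion, a patch of T ([orbit_closure_sub]).

    Two facts about a tiling are used all along: only finitely many tiles meet a given
    ball, and a tile that contains an interior point of another tile is equal to it.
    Both rest on the fact that a tile is the closure of its interior, that is, on
    topological dimension: a set homeomorphic to the d-dimensional ball has interior
    points in d-space ([cube_embedding_interior], [disk_interior_dense]). With
    segments in place of disks in the plane, the theorem would be false.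

    This fact is obtained by a combinatorial route. Let f embed the unit cube in
    d-space with an image A without interior. For each coordinate i cut space
    into a fine cubical grid, and label x according to whether the grid cell of f x
    meets the image of the face x_i = 0. The d labels separate opposite faces, so by a
    theorem of Steinhaus ([cube_steinhaus]) they all change at a common point p, which
    puts f p on the walls of all d grids. If the grids have pairwise disjoint sets of
    wall coordinates, this forces every coordinate of f p to be a wall
    coordinate of some grid, so f p belongs to a countable set; a translation of the
    grids, provided by Baire's theorem, makes that set miss A.

    The discrete form of Steinhaus' theorem ([discrete_steinhaus]) is a degree
    computation modulo 2: the labels are 0-cochains, and the cup product of their
    coboundaries has value 1 on the fundamental chain of the subdivided cube. *)

(** * Steinhaus' theorem on the discrete cube *)

Lemma addF2 (x : 'F_2) : x + x = 0.
Proof. by apply/eqP; case: x => -[|[|]]. Qed.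

Lemma addF2_eq (x y : 'F_2) : x + y = 0 -> x = y.
Proof. by move=> e; rewrite -[x]addr0 -(addF2 y) addrA e add0r. Qed.

(** The predicate e picks one point in each orbit of the involution g. *)
Lemma sum_free_involution (T : finType) (P e : pred T) (g : T -> T)
    (f : T -> 'F_2) :
  involutive g -> (forall x, e (g x) = ~~ e x) -> (forall x, P (g x) = P x) ->
  (forall x, P x -> f (g x) = f x) -> \sum_(x | P x) f x = 0.
Proof.
move=> gK eg Pg fg; rewrite (bigID e) /=.
rewrite [X in X + _](reindex_inj (inv_inj gK)) /=.
rewrite [X in X + _](eq_big (fun x => P x && ~~ e x) f) ?addF2 // => x.
  by rewrite Pg eg.
by rewrite Pg => /andP[/fg].
Qed.

(** The t-th vertex of the edge path from c to c + (1, ..., 1) that moves in direction k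
    at time s k. These vertices span the simplex that s picks in the Freudenthal
    triangulation of the cell at c. *)
Definition walk d N (c : {ffun 'I_d -> 'I_N.+1}) (s : 'S_d) (t : nat) :
  {ffun 'I_d -> nat} := [ffun k => c k + (s k < t)]%N.

(** The cells of the face where exactly the first m coordinates have their top value N;
    such a cell is named by its lowest corner. *)
Definition on_face d N m (c : {ffun 'I_d -> 'I_N.+1}) : bool :=
  [forall j : 'I_d, (c j == N :> nat) == (j < m)%N].

(** The first m directions come last, in a fixed order, so that the earlier part of the
    path runs through each simplex of the face just once. *)
Definition last_steps d m (s : 'S_d) : bool :=
  [forall j : 'I_d, (j < m)%N ==> ((s j + j).+1 == d)].

(** The cup product of the coboundaries of the 0-cochains lam m, ..., lam (m + n - 1). *)
Definition cup_product d N (lam : nat -> {ffun 'I_d -> nat} -> 'F_2) m n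
    (c : {ffun 'I_d -> 'I_N.+1}) (s : 'S_d) : 'F_2 :=
  \prod_(0 <= t < n) (lam (m + t)%N (walk c s t) + lam (m + t)%N (walk c s t.+1)).

Definition face_count d N (lam : nat -> {ffun 'I_d -> nat} -> 'F_2) m n : 'F_2 :=
  \sum_(c : {ffun 'I_d -> 'I_N.+1} | on_face m c) \sum_(s | last_steps m s)
     cup_product lam m n c s.

Definition step_up d N (q : 'I_d) (c : {ffun 'I_d -> 'I_N.+1}) :
  {ffun 'I_d -> 'I_N.+1} :=
  [ffun k => if k == q then inord (c k).+1 else c k].

Definition step_down d N (q : 'I_d) (c : {ffun 'I_d -> 'I_N.+1}) :
  {ffun 'I_d -> 'I_N.+1} :=
  [ffun k => if k == q then inord (c k).-1 else c k].

Lemma last_steps_mulr d m (s r : 'S_d) :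
  (forall x : 'I_d, (d - m <= x)%N -> r x = x) ->
  last_steps m (s * r)%g = last_steps m s.
Proof.
move=> rfix; apply: eq_forallb => j; case: (ltnP j m) => //= jm.
rewrite permM.
have [h|h] := leqP (d - m) (s j); first by rewrite rfix.
have h2 : (r (s j) < d - m)%N.
  rewrite ltnNge; apply/negP => h2.
  have e : r (r (s j)) = r (s j) by apply: rfix.
  by move/perm_inj: e => e; rewrite e leqNgt h in h2.
by apply/eqP/eqP; have := ltn_ord j; lia.
Qed.

(** The count is the same on a face and on the next smaller one. In the cup product on
    the larger face, the label m + 1 + t has its edge at step t + 1 of the path
    ([later]), on the smaller one at step t ([sooner]); in [mixed] the first k labels have
    already been moved back. *)
Section Step.
Context {d N : nat} {lam : nat -> {ffun 'I_d -> nat} -> 'F_2} {m n : nat}.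
Context (mnd : (m + n.+1)%N = d).

Let later (c : {ffun 'I_d -> 'I_N.+1}) s t : 'F_2 :=
  lam (m.+1 + t)%N (walk c s t.+1) + lam (m.+1 + t)%N (walk c s t.+2).
Let sooner (c : {ffun 'I_d -> 'I_N.+1}) s t : 'F_2 :=
  lam (m.+1 + t)%N (walk c s t) + lam (m.+1 + t)%N (walk c s t.+1).
Let mixed (c : {ffun 'I_d -> 'I_N.+1}) k s : 'F_2 :=
  lam m (walk c s 0) *
  ((\prod_(0 <= t < k) sooner c s t) * (\prod_(k <= t < n) later c s t)).

(** For each s, the difference of the two terms does not depend on the vertex k + 1 of
    the path, and exchanging the steps k and k + 1 changes only that vertex. *)
Lemma mixed_step c k : (k < n)%N ->
  \sum_(s | last_steps m s) mixed c k s =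
  \sum_(s | last_steps m s) mixed c k.+1 s.
Proof.
move=> kn.
have k0d : (k < d)%N by lia.
have k1d : (k.+1 < d)%N by lia.
pose r : 'S_d := tperm (Ordinal k0d) (Ordinal k1d).
suff : \sum_(s | last_steps m s) (mixed c k s + mixed c k.+1 s) = 0.
  by rewrite big_split => /addF2_eq.
have wr s t : t != k.+1 -> walk c (s * r)%g t = walk c s t.
  move=> tk; apply/ffunP => x; rewrite !ffunE permM; congr (_ + nat_of_bool _)%N.
  by rewrite /r; case: tpermP => [->|->|//] /=; lia.
apply: (@sum_free_involution _ _ (fun s : 'S_d => odd_perm s) (fun s => s * r)%g).
- by move=> s; rewrite -mulgA tperm2 mulg1.
- move=> s; rewrite odd_permM odd_tperm.
  have -> : (Ordinal k0d != Ordinal k1d) by rewrite -val_eqE /=; lia.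
  by rewrite addbT.
- move=> s; apply: last_steps_mulr => x hx; rewrite tpermD //;
    by rewrite -val_eqE /=; lia.
- have E s : mixed c k s + mixed c k.+1 s = lam m (walk c s 0) *
      ((\prod_(0 <= t < k) sooner c s t) * (\prod_(k.+1 <= t < n) later c s t)) *
      (lam (m.+1 + k)%N (walk c s k) + lam (m.+1 + k)%N (walk c s k.+2)).
    rewrite /mixed (big_ltn kn) big_nat_recr //=.
    set A := \prod_(0 <= _ < k) _; set B := \prod_(k.+1 <= _ < n) _.
    rewrite -[RHS]addr0 -(mulr0 (lam m (walk c s 0) * (A * B))).
    rewrite -(addF2 (lam (m.+1 + k)%N (walk c s k.+1))) /later /sooner.
    ring.
  move=> s _; rewrite !E !wr ?andbT; try lia.
  congr (_ * (_ * _) * _).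
    apply: eq_big_nat => t ht; rewrite /sooner !wr //; lia.
  apply: eq_big_nat => t ht; rewrite /later !wr //; lia.
Qed.

Lemma cup_product_split c s :
  cup_product lam m n.+1 c s =
  mixed c 0 s + lam m (walk c s 1) * \prod_(0 <= t < n) later c s t.
Proof.
rewrite /cup_product big_nat_recl // addn0 mulrDl /mixed.
have -> : \prod_(0 <= t < 0) sooner c s t = 1 by rewrite big_geq.
rewrite mul1r; by congr (_ * _ + _ * _); apply: eq_bigr => t _; rewrite /later addSnnS.
Qed.

Let n_lt_d : (n < d)%N.
Proof. by rewrite -mnd addnS ltnS leq_addl. Qed.

Let d_gt0 : (0 < d)%N.
Proof. exact: leq_ltn_trans n_lt_d. Qed.

(** Moves the first of the steps 0, ..., n to the end. *)
Let back (x : 'I_d) : 'I_d :=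
  if x == Ordinal d_gt0 then Ordinal n_lt_d else
  if (x <= n)%N then Ordinal (leq_ltn_trans (leq_pred x) (ltn_ord x)) else x.

Let val_back x :
  back x = (if x == 0 :> nat then n else if x <= n then x.-1 else x)%N :> nat.
Proof. by rewrite /back -val_eqE /=; case: ifP => // _; case: ifP. Qed.

Let back_inj : injective back.
Proof.
move=> x y /(congr1 val); rewrite /= !val_back => e; apply: val_inj => /=.
by move: e; do 4?case: ifP; lia.
Qed.

Let rot : 'S_d := perm back_inj.
Let top (s : 'S_d) : 'I_d := (s^-1)%g (Ordinal n_lt_d).

(** Dropping the first vertex of a path gives the beginning of the path that starts at
    its second vertex and puts the first step after step n. *)
Lemma walk_rot (c : {ffun 'I_d -> 'I_N.+1}) s t :
  (t <= n)%N -> on_face m c -> last_steps m s ->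
  walk c s t.+1 = walk (step_up (top (s * rot)%g) c) (s * rot)%g t.
Proof.
move=> tn /forallP cm /forallP sm.
set q := top _.
have qE : rot (s q) = Ordinal n_lt_d by rewrite -permM /q /top permKV.
have sq : s q = Ordinal d_gt0.
  apply: (@perm_inj _ rot); by rewrite qE permE /back eqxx.
have qm : (m <= q)%N.
  rewrite leqNgt; apply/negP => qm.
  by move: (sm q); rewrite qm sq /=; lia.
have cq : (c q < N)%N.
  by move: (cm q) (ltn_ord (c q)); rewrite ltnS; lia.
apply/ffunP => x; rewrite !ffunE permM permE /back.
have [->|xq] := eqVneq x q.
  rewrite sq eqxx /= inordK //.
  by rewrite ltnNge tn addn0 addn1.
have : s x != s q by rewrite (inj_eq perm_inj).
rewrite sq -val_eqE -/(back _) val_back /= => sx0.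
rewrite (negbTE sx0); by congr (_ + nat_of_bool _)%N; case: ifP; lia.
Qed.

(** A form of Stokes' formula: the paired terms are the values of one cochain on two
    simplices that differ by a translation in the direction of step n, and lie on opposite
    faces of the cell at c. *)
Lemma face_count_paired :
  face_count N lam m n.+1 =
  \sum_(s | last_steps m s) \sum_(c : {ffun 'I_d -> 'I_N.+1} | on_face m c)
    (mixed c n s + mixed (step_up (top s) c) n s).
Proof.
rewrite /face_count.
under eq_bigr => c _ do (under eq_bigr => s _ do rewrite cup_product_split;
  rewrite big_split /=).
rewrite big_split /= exchange_big /=.
rewrite [RHS](eq_bigr _ (fun s _ => big_split _ _ _ _ _)) /= big_split /=.
congr (_ + _).
  rewrite exchange_big [RHS]exchange_big /=; apply: eq_bigr => c _.
  have : forall k, (k <= n)%N -> \sum_(s | last_steps m s) mixed c 0 s =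
    \sum_(s | last_steps m s) mixed c k s.
    elim=> // k IH kn; rewrite IH; last exact: ltnW.
    exact: mixed_step.
  exact.
rewrite exchange_big /= [RHS](reindex_inj (mulIg rot)) /=.
apply: eq_big => [s|s sm].
  rewrite last_steps_mulr // => x hx; apply: val_inj.
  by rewrite permE /= val_back; do 2?case: ifP; lia.
apply: eq_bigr => c cm.
rewrite /mixed walk_rot //; congr (_ * _).
rewrite [X in _ * X]big_geq // mulr1; apply: eq_big_nat => t ht.
by rewrite /later /sooner !(@walk_rot c s) //; lia.
Qed.

Context (N_gt0 : (0 < N)%N).
Context (lam0 : forall (i : 'I_d) (x : {ffun 'I_d -> nat}),
  x i = 0%N -> lam i x = 0).
Context (lamN : forall (i : 'I_d) (x : {ffun 'I_d -> nat}),
  x i = N -> lam i x = 1).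

(** The sum in [face_count_paired] telescopes in the direction q of step n and leaves the
    faces c q = 0 and c q = N. If q is not m, the label q is constant on both and its
    coboundary is 0; if q is m, the label m is 0 on one face and 1 on the other. *)
Lemma face_countS : face_count N lam m n.+1 = face_count N lam m.+1 n.
Proof.
rewrite face_count_paired /face_count [RHS]exchange_big /=.
have m_lt_d : (m < d)%N by rewrite -mnd; lia.
pose om := Ordinal m_lt_d.
have last_stepsS s : last_steps m.+1 s = last_steps m s && (top s == om).
  apply/forallP/andP => [h|[/forallP h /eqP t] j].
    split; first by apply/forallP => j; apply/implyP => jm;
      move: (h j); rewrite ltnS (ltnW jm).
    move: (h om); rewrite /= ltnSn /= => /eqP e.
    rewrite /top; apply/eqP/(@perm_inj _ s); rewrite permKV; apply: val_inj => /=.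
    lia.
  apply/implyP; rewrite ltnS leq_eqVlt => /orP[/eqP jm|jm]; last by
    move: (h j); rewrite jm.
  have -> : j = om by apply: val_inj.
  rewrite -t /top permKV /= -/(top s) t /=; lia.
rewrite [RHS](eq_bigl _ _ last_stepsS).
rewrite [RHS]big_mkcondr /=.
apply: eq_bigr => s sm; set q := top s.
have sq : s q = Ordinal n_lt_d by rewrite /q /top permKV.
have qm : (m <= q)%N.
  rewrite leqNgt; apply/negP => qm.
  by move/forallP: sm => /(_ q); rewrite qm sq /=; lia.
pose R (c : {ffun 'I_d -> 'I_N.+1}) :=
  [forall j : 'I_d, (j != q) ==> ((c j == N :> nat) == (j < m)%N)].
have onR c : on_face m c = R c && (c q < N)%N.
  apply/forallP/andP => [h|[/forallP h cq] j].
    split; first by apply/forallP => j; rewrite h implybT.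
    move: (h q) (ltn_ord (c q)); rewrite ltnS; lia.
  have [->|jq] := eqVneq j q; first by lia.
  by move: (h j); rewrite jq.
have up_sum : \sum_(c : {ffun 'I_d -> 'I_N.+1} | on_face m c)
      mixed (step_up q c) n s =
    \sum_(c | R c && (0 < c q)%N) mixed c n s.
  rewrite [RHS](reindex_onto (step_up q) (step_down q)) /=; last first.
    move=> c /andP[_ c0]; apply/ffunP => x; rewrite !ffunE.
    case: eqP => // ->.
    apply: val_inj; rewrite /= inordK inordK ?prednK //.
    by have := ltn_ord (c q); lia.
    by have := ltn_ord (c q); lia.
  apply: eq_bigl => c; rewrite onR.
  have -> : R (step_up q c) = R c.
    by apply: eq_forallb => j; rewrite ffunE; case: eqP.
  case: (R c) => //=; rewrite ffunE eqxx.
  have := ltn_ord (c q); rewrite ltnS leq_eqVlt => /orP[/eqP cN|cN].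
    by rewrite cN ltnn /inord val_insubd ltnn.
  rewrite cN inordK //=; apply/esym/eqP/ffunP => x; rewrite !ffunE.
  by case: eqP => // ->; rewrite inordK //= inord_val.
(* A cell with 0 < c q < N is counted twice. *)
rewrite big_split /= up_sum (eq_bigl _ _ onR) !big_mkcondr -big_split /=.
have wq (c : {ffun 'I_d -> 'I_N.+1}) t : (t <= n)%N -> walk c s t q = c q.
  by move=> tn; rewrite ffunE sq /= ltnNge tn addn0.
have mixedE c : mixed c n s = lam m (walk c s 0) * cup_product lam m.+1 n c s.
  by rewrite /mixed [X in _ * (_ * X)]big_geq // mulr1.
rewrite -/q; have [qom|qom] := eqVneq q om.
  have qm' : q = m :> nat by rewrite qom.
  have onRS c : on_face m.+1 c = R c && (c q == N :> nat).
    apply/forallP/andP => [h|[/forallP h cq] j].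
      split; last by have := h q; lia.
      apply/forallP => j; apply/implyP; rewrite -val_eqE /=.
      by have := h j; lia.
    have := h j; rewrite -val_eqE /=.
    have [->|jq] := eqVneq j q; last by rewrite -val_eqE /= in jq; lia.
    by rewrite eqxx; lia.
  rewrite [RHS](eq_bigl _ _ onRS) [RHS]big_mkcondr /=; apply: eq_bigr => c _.
  rewrite mixedE; have := wq c 0 (leq0n _); rewrite {1}qom => w.
  have := ltn_ord (c q); rewrite ltnS leq_eqVlt => /orP[/eqP cN|cN].
    by rewrite cN ltnn N_gt0 eqxx (lamN (i := om)) ?w // mul1r add0r.
  rewrite cN ltn_eqF //; case: posnP => [c0|_]; last exact: addF2.
  by rewrite (lam0 (i := om)) ?w // mul0r add0r.
apply: big1 => c _; have [/andP[c0 cN]|h] := boolP (0 < c q < N)%N.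
  by rewrite c0 cN addF2.
suff -> : mixed c n s = 0 by case: ifP; case: ifP; rewrite !addr0.
have qmn : (q - m.+1 < n)%N.
  have qm' : q != m :> nat by rewrite -val_eqE in qom.
  by have := ltn_ord q; lia.
have mq : (m.+1 + (q - m.+1))%N = q.
  by apply: subnKC; rewrite ltn_neqAle eq_sym qm andbT -val_eqE in qom *.
rewrite mixedE /cup_product big_mkord (bigD1 (Ordinal qmn)) //= mq.
suff -> : lam q (walk c s (q - m.+1)) = lam q (walk c s (q - m.+1).+1).
  by rewrite addF2 mul0r mulr0.
have [c0|c0] := posnP (c q); first by rewrite !lam0 ?wq //; lia.
have cN : c q = N :> nat by have := ltn_ord (c q); lia.
by rewrite !lamN ?wq //; lia.
Qed.
End Step.

Lemma face_count_last d N (lam : nat -> {ffun 'I_d -> nat} -> 'F_2) :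
  face_count N lam d 0 = 1.
Proof.
rewrite /face_count (big_pred1 [ffun=> ord_max]) => [|c].
  rewrite (big_pred1 (perm (@rev_ord_inj d))) => [|s].
    by rewrite /cup_product big_geq.
  apply/forallP/eqP => [h|-> j].
    apply/permP => j; rewrite permE; apply: val_inj => /=.
    by have /eqP e := implyP (h j) (ltn_ord j); rewrite -[X in (X - _)%N]e subSS addnK.
  by rewrite ltn_ord permE /=; have := ltn_ord j; lia.
apply/forallP/eqP => [h|-> j]; last by rewrite ffunE /= eqxx ltn_ord.
apply/ffunP => j; rewrite ffunE; apply: val_inj => /=.
by have := h j; rewrite ltn_ord => /eqP/eqP.
Qed.

(** The cup product of the d coboundaries has value 1 on the cube, so it is nonzero on
    some path: the label i changes at the i-th step of that path. *)
Theorem discrete_steinhaus d N (lam : 'I_d -> {ffun 'I_d -> nat} -> bool) :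
  (0 < N)%N ->
  (forall i (x : {ffun 'I_d -> nat}), x i = 0%N -> lam i x = false) ->
  (forall i (x : {ffun 'I_d -> nat}), x i = N -> lam i x = true) ->
  exists c : {ffun 'I_d -> nat}, (forall k, (c k < N)%N) /\
    forall i, exists v w : {ffun 'I_d -> nat},
      [/\ forall k, (c k <= v k <= (c k).+1)%N,
          forall k, (c k <= w k <= (c k).+1)%N & lam i v != lam i w].
Proof.
move=> N0 l0 lN.
pose lam' (i : nat) (x : {ffun 'I_d -> nat}) : 'F_2 :=
  (if insub i is Some j then lam j x else false)%:R.
have lamE (i : 'I_d) (x : {ffun 'I_d -> nat}) : lam' i x = (lam i x)%:R.
  by rewrite /lam' valK.
have W m n : (m + n)%N = d -> face_count N lam' m n = 1.
  elim: n m => [m|n IH m] mn.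
    by rewrite addn0 in mn; rewrite [m]mn; exact: face_count_last.
  rewrite face_countS //; first by apply: IH; rewrite addSnnS.
    by move=> i x xi; rewrite lamE l0.
  by move=> i x xi; rewrite lamE lN.
have : face_count N lam' 0 d != 0 by rewrite W // oner_eq0.
rewrite /face_count => W0.
have [c /andP[cN]] : exists c : {ffun 'I_d -> 'I_N.+1}, on_face 0 c &&
    (\sum_(s | last_steps 0 s) cup_product lam' 0 d c s != 0).
  apply/existsP; apply: contraNT W0; rewrite negb_exists => /forallP h.
  rewrite big1 // => c cN; apply/eqP.
  by have := h c; rewrite cN negbK.
move=> W1.
have [s sP] : exists s : 'S_d, cup_product lam' 0 d c s != 0.
  apply/existsP; apply: contraNT W1; rewrite negb_exists => /forallP h.
  rewrite big1 // => s _; apply/eqP.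
  by have := h s; rewrite negbK.
exists [ffun k => c k : nat]; split => [k|i].
  by rewrite ffunE; have := forallP cN k; have := ltn_ord (c k); lia.
exists (walk c s i), (walk c s i.+1); split => [k|k|].
- by rewrite !ffunE; case: (_ < _)%N; lia.
- by rewrite !ffunE; case: (_ < _)%N; lia.
apply: contraNneq sP => e.
by rewrite /cup_product big_mkord (bigD1 i) //= add0n !lamE e addF2 mul0r.
Qed.

(** * Steinhaus' theorem on the unit cube *)

Section RowNorm.
Context {R : realType} {d : nat}.
Implicit Types (x : 'rV[R]_d) (e : R).

Lemma row_norm_lt x e : 0 < e -> (forall i, `|x ord0 i| < e) -> `|x| < e.
Proof.
move=> e0 h; rewrite [ltLHS]mx_normrE; apply: bigmax_lt => // -[i j] _ /=.
by rewrite ord1.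
Qed.

Lemma row_norm_le x e : 0 <= e -> (forall i, `|x ord0 i| <= e) -> `|x| <= e.
Proof.
move=> e0 h; rewrite [leLHS]mx_normrE; apply: bigmax_le => // -[i j] _ /=.
by rewrite ord1.
Qed.

Lemma le_row_norm x i : `|x ord0 i| <= `|x|.
Proof. by rewrite [leRHS]mx_normrE; apply: (@le_bigmax _ _ _ _ _ (ord0, i)). Qed.

Lemma nbhs_row (p : 'rV[R]_d) (A : set 'rV[R]_d) :
  nbhs p A <-> exists2 e : R, 0 < e & forall x, `|x - p| < e -> A x.
Proof.
rewrite -nbhs_ballE; split=> -[e /= e0 h]; exists e => // x.
  by rewrite distrC => xe; apply: h; rewrite -ball_normE.
by rewrite -ball_normE /= distrC; apply: h.
Qed.

Lemma compact_cluster (K : set 'rV[R]_d) (u : nat -> 'rV[R]_d) :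
  compact K -> (forall n, K (u n)) ->
  exists2 p, K p & forall e M, 0 < e -> exists2 n, (M <= n)%N & `|u n - p| < e.
Proof.
move=> cK Ku.
have [|p [Kp cp]] := cK (u @ \oo) _.
  by exists 0%N => // n _ /=; exact: Ku.
exists p => // e M e0.
have tail : (u @ \oo) (u @` [set n | (M <= n)%N]).
  by exists M => // n /= Mn; exists n.
have near_p : nbhs p [set x | `|x - p| < e] by apply/nbhs_row; exists e.
by have [_ [[n /= Mn <-] un]] := cp _ _ tail near_p; exists n.
Qed.

Lemma compact_closed_gap (K C : set 'rV[R]_d) :
  compact K -> closed C -> K `&` C = set0 ->
  exists2 e : R, 0 < e & forall x y, K x -> C y -> e <= `|x - y|.
Proof.
move=> cK cC KC0; apply: contrapT => no.
have : forall n : nat, exists xy : 'rV[R]_d * 'rV[R]_d,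
    [/\ K xy.1, C xy.2 & `|xy.1 - xy.2| < n.+1%:R^-1].
  move=> n; apply: contrapT => h; apply: no; exists n.+1%:R^-1 => [|x y Kx Cy].
    by rewrite invr_gt0.
  by rewrite leNgt; apply/negP => lt; apply: h; exists (x, y).
move=> /choice[u uP].
have [n|p Kp cp] := compact_cluster cK (u := fun n => (u n).1) _.
  by case: (uP n).
have : nbhs p (~` C).
  apply: open_nbhs_nbhs; split; first exact: closed_openC.
  by move=> Cp; have : (K `&` C) p by []; rewrite KC0.
move=> /nbhs_row[e e0 h].
have e20 : 0 < e / 2 by rewrite divr_gt0.
have [M _ MP] : \forall n \near \oo, n.+1%:R^-1 < e / 2.
  exact: near_infty_natSinv_lt (PosNum e20).
have [n Mn ne] := cp _ M e20; case: (uP n) => _ Cu lt.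
apply: (h (u n).2) => //.
have lt2 := MP n Mn.
rewrite -(subrK (u n).1 (u n).2) -addrA (le_lt_trans (ler_normD _ _)) //.
by rewrite distrC [ltRHS]splitr ltrD // (lt_trans lt).
Qed.
End RowNorm.

Lemma finite_pos_lower_bound (R : realType) (I : finType) (P : I -> R -> Prop) :
  (forall i e e', 0 < e' -> e' <= e -> P i e -> P i e') ->
  (forall i, exists2 e, 0 < e & P i e) ->
  exists2 e, 0 < e & forall i, P i e.
Proof.
move=> mono ex.
have /choice[e eP] : forall i, exists e, 0 < e /\ P i e.
  by move=> i; have [e] := ex i; exists e.
exists (\big[Num.min/1]_i e i) => [|i].
  by apply: lt_bigmin => // i _; case: (eP i).
apply: (mono i (e i)); last by case: (eP i).
  by apply: lt_bigmin => // j _; case: (eP j).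
exact: bigmin_le_cond.
Qed.

Section Cube.
Context {R : realType} {d : nat}.

Definition unit_cube : set 'rV[R]_d := [set x | forall i, 0 <= x ord0 i <= 1].

Lemma unit_cube_compact : compact unit_cube.
Proof.
have := @rV_compact R d (fun=> `[0, 1]%classic) (fun=> @segment_compact R 0 1).
congr compact; apply/seteqP; split => x /= h i; have := h i;
  by rewrite /= in_itv.
Qed.

(** Apply [discrete_steinhaus] to the labels at the points of ever finer grids; the cells
    obtained cluster at a point of the compact cube. *)
Theorem cube_steinhaus (lam : 'I_d -> 'rV[R]_d -> bool) :
  (forall i x, unit_cube x -> x ord0 i = 0 -> lam i x = false) ->
  (forall i x, unit_cube x -> x ord0 i = 1 -> lam i x = true) ->
  exists2 p, unit_cube p & forall i e, 0 < e ->
    exists v w, [/\ unit_cube v, unit_cube w, `|v - p| < e, `|w - p| < e &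
                    lam i v != lam i w].
Proof.
move=> lam0 lam1.
(* Coordinates are clamped, as the labels of the discrete cube live on all of N^d. *)
pose pt N (x : {ffun 'I_d -> nat}) : 'rV[R]_d :=
  \row_k ((minn (x k) N.+1)%:R / N.+1%:R).
have ptE N (x : {ffun 'I_d -> nat}) k : pt N x ord0 k = (minn (x k) N.+1)%:R / N.+1%:R.
  by rewrite mxE.
have N1 N : (0 : R) < N.+1%:R by rewrite ltr0n.
have pt_cube N x : unit_cube (pt N x).
  move=> k; rewrite ptE divr_ge0 //= ler_pdivrMr // mul1r ler_nat.
  exact: geq_minr.
have /choice[c cP] : forall N, exists c : {ffun 'I_d -> nat},
    (forall k, (c k < N.+1)%N) /\
    forall i, exists v w : {ffun 'I_d -> nat},
      [/\ forall k, (c k <= v k <= (c k).+1)%N,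
          forall k, (c k <= w k <= (c k).+1)%N &
          lam i (pt N v) != lam i (pt N w)].
  move=> N; apply: (@discrete_steinhaus d N.+1 (fun i x => lam i (pt N x))) => // i x xi.
    by apply: lam0 => //; rewrite ptE xi min0n mul0r.
  by apply: lam1 => //; rewrite ptE xi minnn divff // gt_eqF.
have [p pc clp] := compact_cluster unit_cube_compact (fun N => pt_cube N (c N)).
exists p => // i e e0.
have e20 : 0 < e / 2 by rewrite divr_gt0.
have [M _ MP] : \forall n \near \oo, n.+1%:R^-1 < e / 2.
  exact: near_infty_natSinv_lt (PosNum e20).
have [N MN Np] := clp _ M e20.
have [cN /(_ i)[v [w [cv cw vw]]]] := cP N.
have near (x : {ffun 'I_d -> nat}) : (forall k, (c N k <= x k <= (c N k).+1)%N) ->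
    `|pt N x - p| < e.
  move=> cx; rewrite -(subrK (pt N (c N)) (pt N x)) -addrA.
  rewrite (le_lt_trans (ler_normD _ _)) //.
  rewrite [ltRHS]splitr ltrD //.
  apply: row_norm_lt => // k; rewrite !mxE -mulrBl normrM [X in _ * X]ger0_norm ?invr_ge0 //.
  apply: le_lt_trans (MP N MN); rewrite ler_piMl ?invr_ge0 //.
  have := cx k; have := cN k => h1 h2.
  rewrite (minn_idPl (ltnW h1)) -natrB; last by lia.
  by rewrite normr_nat lern1; lia.
exists (pt N v), (pt N w); split => //; exact: near.
Qed.
End Cube.

(** * Embeddings of the cube have interior points *)

Lemma within_continuous_epsP (R : realType) (d k : nat) (A : set 'rV[R]_d)
    (f : 'rV[R]_d -> 'rV[R]_k) :
  {within A, continuous f} <->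
  forall x, A x -> forall e : R, 0 < e -> exists2 del : R, 0 < del &
    forall y, A y -> `|y - x| < del -> `|f y - f x| < e.
Proof.
split => [/subspace_continuousP fc x Ax e e0|h].
  have : within A (nbhs x) [set y | `|f y - f x| < e].
    apply: (fc x Ax [set z | `|z - f x| < e]).
    by apply/nbhs_row; exists e.
  by move=> /nbhs_row[del d0 hd]; exists del => // y Ay yx; apply: hd.
apply/subspace_continuousP => x Ax V /nbhs_row[e e0 eV].
have [del d0 hd] := h x Ax e e0.
by apply/nbhs_row; exists del => // y yx Ay; apply: eV; exact: hd.
Qed.

Lemma floor_locally_constant (R : realType) (x : R) :
  (forall k : int, x <> k%:~R) ->
  exists2 e : R, 0 < e & forall y, `|y - x| < e -> Num.floor y = Num.floor x.
Proof.
move=> nint; have /andP[lo hi] := floor_itv x.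
have lo' : (Num.floor x)%:~R < x by rewrite lt_neqAle lo andbT; apply/eqP => /esym/nint.
exists (Num.min (x - (Num.floor x)%:~R) ((Num.floor x + 1)%:~R - x)).
  by rewrite lt_min !subr_gt0 lo' hi.
move=> y; rewrite lt_min => /andP[]; rewrite !ltr_norml => /andP[h1 _] /andP[_ h2].
by apply: floor_def; lra.
Qed.

(** Joins the complete and the normed structure of matrices, for Baire's theorem. *)
HB.instance Definition _ (R : realType) (m n : nat) :=
  Uniform_isComplete.Build 'M[R]_(m, n) (@cauchy_cvg _).

(** A weak form of invariance of domain, and the topological heart of the proof. *)
Theorem cube_embedding_interior (R : realType) (d : nat)
    (f : 'rV[R]_d -> 'rV[R]_d) :
  {within unit_cube, continuous f} ->
  (forall x y, unit_cube x -> unit_cube y -> f x = f y -> x = y) ->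
  (f @` unit_cube)° !=set0.
Proof.
move=> fcont finj; apply: contrapT => noint.
pose A := f @` unit_cube.
have Acomp : compact A := continuous_compact fcont unit_cube_compact.
have Aclosed : closed A by apply: compact_closed => //; exact: norm_hausdorff.
pose face i (b : R) : set 'rV[R]_d := [set x | unit_cube x /\ x ord0 i = b].
have face_compact i b : compact (f @` face i b).
  apply: continuous_compact.
    by apply: continuous_subspaceW fcont => x [].
  apply: (subclosed_compact _ unit_cube_compact) => [|x [] //].
  have -> : face i b = unit_cube `&` (fun x => x ord0 i) @^-1` [set b].
    by apply/seteqP; split.
  apply: closedI.
    by apply: compact_closed; [exact: norm_hausdorff|exact: unit_cube_compact].
  apply: closed_comp; last exact: closed_eq.
  by move=> x _; exact: coord_continuous.
(* A mesh finer than the distance between the images of opposite faces. *)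
have [eta eta0 gap] : exists2 eta : R, 0 < eta & forall (i : 'I_d) x y,
    face i 0 x -> face i 1 y -> eta <= `|f x - f y|.
  apply: (@finite_pos_lower_bound R 'I_d (fun i e => forall x y,
     face i 0 x -> face i 1 y -> e <= `|f x - f y|)).
    by move=> i e e' _ ee h x y fx fy; apply: le_trans (h x y fx fy).
  move=> i.
  have [|||e e0 h] := @compact_closed_gap R d (f @` face i 0) (f @` face i 1).
  - exact: face_compact.
  - by apply: compact_closed; [exact: norm_hausdorff|exact: face_compact].
  - apply/seteqP; split => // _ [[x [cx x0] <-] [y [cy y1] yx]].
    have := finj _ _ cy cx yx => yx'; move: y1; rewrite yx' x0 => /eqP.
    by rewrite eq_sym oner_eq0.
  - by exists e => // x y fx fy; apply: h; [exists x|exists y].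
(* The walls of different grids have different fractional parts. *)
pose theta (i : 'I_d) : R := i%:R / d%:R.
pose grid_point (z : {ffun 'I_d -> 'I_d * int}) : 'rV[R]_d :=
  \row_j (eta * (theta (z j).1 + (z j).2%:~R)).
(* Baire: shift the grids so that the image avoids their countably many common points. *)
have [s savoid] : exists s, forall z, ~ A (s + grid_point z).
  pose U n : set 'rV[R]_d :=
    if unpickle n is Some z then [set s | ~ A (s + grid_point z)] else setT.
  have Uod n : open (U n) /\ dense (U n).
    rewrite /U; case: unpickle => [z|]; last first.
      by split; [exact: openT|move=> O O0 _; rewrite setIT].
    split.
      rewrite (_ : [set s | _] = (fun s => s + grid_point z) @^-1` (~` A)) //.
      apply: open_comp; last exact: (closed_openC Aclosed).
      move=> x _ V /nbhs_row[e e0 eV]; apply/nbhs_row; exists e => // y ye.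
      by apply: eV; rewrite opprD addrACA subrr addr0.
    move=> O [x Ox] Oo; apply: contrapT => h; apply: noint.
    exists (x + grid_point z); move: Oo; rewrite openE => /(_ x Ox)/nbhs_row[e e0 eO].
    apply/nbhs_row; exists e => // y ye; apply: contrapT => nAy.
    apply: h; exists (y - grid_point z); split; last by rewrite /= subrK.
    by apply: eO; rewrite -addrA -opprD (addrC _ x).
  have [|s [_ sU]] := Baire Uod (O := setT) _ openT; first by exists 0.
  exists s => z; have := sU (pickle z) I.
  by rewrite /U pickleK.
pose coord (i j : 'I_d) (y : 'rV[R]_d) : R := (y ord0 j - s ord0 j) / eta - theta i.
pose cell (i : 'I_d) (y : 'rV[R]_d) : {ffun 'I_d -> int} :=
  [ffun j => Num.floor (coord i j y)].
have cell_small i x y : cell i x = cell i y -> `|x - y| < eta.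
  move=> /ffunP e; apply: row_norm_lt => // j.
  have := e j; rewrite !ffunE => ej.
  have /andP[x1 x2] := floor_itv (coord i j x).
  have /andP[y1 y2] := floor_itv (coord i j y).
  have -> : (x - y) ord0 j = eta * (coord i j x - coord i j y).
    by rewrite !mxE /coord; field; rewrite gt_eqF.
  rewrite normrM gtr0_norm // gtr_pMr // ltr_norml.
  by rewrite ej in x1 x2; rewrite intrD in x2 y2; apply/andP; split; lra.
pose lam (i : 'I_d) (x : 'rV[R]_d) : bool :=
  ~~ `[< exists2 c, face i 0 c & cell i (f c) = cell i (f x) >].
have [||p pc hp] := @cube_steinhaus R d lam.
- move=> i x cx x0; apply/negbTE; rewrite negbK; apply/asboolP.
  by exists x.
- move=> i x cx x1; apply/negP => /asboolP[c fc e].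
  have := cell_small _ _ _ e; rewrite ltNge => /negP; apply.
  by apply: (gap i).
have /choice[j /choice[k jk]] : forall i, exists j, exists k : int,
    coord i j (f p) = k%:~R.
  move=> i; apply: contrapT => no.
  have [e e0 he] : exists2 e : R, 0 < e & forall j y,
      `|y - f p| < e -> Num.floor (coord i j y) = Num.floor (coord i j (f p)).
    apply: (@finite_pos_lower_bound R 'I_d (fun j e => forall y,
      `|y - f p| < e -> Num.floor (coord i j y) = Num.floor (coord i j (f p)))).
      by move=> j e e' _ ee h y ye; apply: h; apply: lt_le_trans ee.
    move=> j.
    have [|e e0 he] := @floor_locally_constant R (coord i j (f p)).
      by move=> k hk; apply: no; exists j, k.
    exists (eta * e); first exact: mulr_gt0.
    move=> y ye; apply: he.
    have -> : coord i j y - coord i j (f p) = (y - f p) ord0 j / eta.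
      by rewrite !mxE /coord; field; rewrite gt_eqF.
    rewrite normrM normfV (gtr0_norm eta0) ltr_pdivrMr // mulrC.
    exact: le_lt_trans (le_row_norm _ _) _.
  have [del del0 hdel] := (within_continuous_epsP _ _).1 fcont p pc e e0.
  have [v [w [cv cw vp wp]]] := hp i del del0.
  have near x : unit_cube x -> `|x - p| < del -> cell i (f x) = cell i (f p).
    by move=> cx xp; apply/ffunP => l; rewrite !ffunE; apply: he; apply: hdel.
  by rewrite /lam near // near // eqxx.
(* The point lies on a wall of grid i in direction j i; no wall coordinate is common to
   two grids, so these directions are distinct and use up all coordinates. *)
have jinj : injective j.
  move=> i i' jj.
  have := jk i; have := jk i'; rewrite -jj /coord => e' e.
  have : theta i' - theta i = (k i - k i')%:~R by rewrite intrB -e -e'; ring.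
  have d0 : (0 : R) < d%:R by rewrite ltr0n (leq_ltn_trans _ (ltn_ord i)).
  have lt1 l : theta l < 1 by rewrite /theta ltr_pdivrMr // mul1r ltr_nat.
  have ge0 l : 0 <= theta l by rewrite /theta divr_ge0.
  move=> et; have := lt1 i; have := lt1 i'; have := ge0 i; have := ge0 i' => h1 h2 h3 h4.
  have k1 : k i - k i' < 1 by rewrite -(ltr_int R) -et; lra.
  have k2 : -1 < k i - k i' by rewrite -(ltr_int R) -et; lra.
  have k3 : k i - k i' = 0 by lia.
  move: et; rewrite k3 => /eqP; rewrite subr_eq0 /theta => /eqP.
  by move/(mulIf (invr_neq0 (lt0r_neq0 d0)))/eqP; rewrite eqr_nat => /eqP/esym/val_inj.
have [g gj jg] := injF_bij jinj.
apply: (savoid [ffun l => (g l, k (g l))]).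
exists p => //; apply/rowP => l; rewrite !mxE ffunE /=.
have := jk (g l); rewrite jg => <-; rewrite /coord.
by field; rewrite gt_eqF.
Qed.

(** * Topological disks and Euclidean motions *)

Lemma finite_upper_bound (R : realType) (T : Type) (A : set T) (P : T -> R -> Prop) :
  finite_set A -> (forall t e e', e <= e' -> P t e -> P t e') ->
  (forall t, A t -> exists e, P t e) ->
  exists2 e, 0 < e & forall t, A t -> P t e.
Proof.
move=> /(@finite_seqP {classic T} A)[s ->] mono.
elim: s => [|t s IH] h; first by exists 1.
have [u us|e e0 he] := IH; first by apply: h; rewrite /= inE us orbT.
have [|e' he'] := h t; first by rewrite /= inE eqxx.
exists (Num.max e e') => [|u]; first by rewrite lt_max e0.
rewrite /= inE => /predU1P[->|us]; first by apply: mono he'; rewrite le_max lexx orbT.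
by apply: (mono _ e); [rewrite le_max lexx|exact: he].
Qed.

Section Disks.
Context {R : realType} {d : nat}.
Implicit Types (r : R) (x y : 'rV[R]_d) (A : set 'rV[R]_d) (g : motion R d).

Lemma closed_ball0P r x : 0 <= r ->
  closed_ball0 r x <-> \sum_i x ord0 i ^+ 2 <= r ^+ 2.
Proof.
move=> r0; rewrite /closed_ball0 /eucl_norm /= big_ord1.
have S0 : 0 <= \sum_i x ord0 i ^+ 2 by apply: sumr_ge0 => i _; exact: sqr_ge0.
split=> h; last by rewrite -(ger0_norm r0) -sqrtr_sqr ler_wsqrtr.
by rewrite -(sqr_sqrtr S0) lerXn2r // nnegrE ?sqrtr_ge0.
Qed.

Lemma closed_ball0_norm r x : 0 <= r -> closed_ball0 r x -> `|x| <= r.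
Proof.
move=> r0 /(closed_ball0P _ r0) h; apply: row_norm_le => // i.
rewrite -(ler_pXn2r (_ : 0 < 2)%N) ?nnegrE // -normrX ger0_norm ?sqr_ge0 //.
apply: le_trans h; rewrite (bigD1 i) //= lerDl.
by apply: sumr_ge0 => j _; exact: sqr_ge0.
Qed.

Lemma norm_closed_ball0 r x : 0 <= r -> d%:R * `|x| <= r -> closed_ball0 r x.
Proof.
move=> r0 h; apply/closed_ball0P => //.
have : \sum_i x ord0 i ^+ 2 <= \sum_(i < d) `|x| ^+ 2.
  apply: ler_sum => i _; rewrite -[x ord0 i ^+ 2]ger0_norm ?sqr_ge0 // normrX.
  by rewrite lerXn2r ?nnegrE //; exact: le_row_norm.
move=> /le_trans; apply; rewrite sumr_const card_ord -mulr_natl.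
apply: (@le_trans _ _ ((d%:R * `|x|) ^+ 2)); last by rewrite lerXn2r ?nnegrE ?mulr_ge0.
rewrite exprMn ler_wpM2r ?sqr_ge0 // -natrX ler_nat.
by case: (d) => // n; rewrite leq_pmulr.
Qed.

Lemma closed_ball0_convex x y (s : R) : 0 <= s <= 1 ->
  closed_ball0 1 x -> closed_ball0 1 y -> closed_ball0 1 ((1 - s) *: x + s *: y).
Proof.
move=> /andP[s0 s1] /(closed_ball0P _ ler01) bx /(closed_ball0P _ ler01) bY.
apply/(closed_ball0P _ ler01); rewrite expr1n in bx bY *.
have : \sum_i ((1 - s) *: x + s *: y) ord0 i ^+ 2 <=
    \sum_i ((1 - s) * x ord0 i ^+ 2 + s * y ord0 i ^+ 2).
  apply: ler_sum => i _; rewrite !mxE -subr_ge0.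
  set a := x _ _; set b := y _ _.
  have -> : (1 - s) * a ^+ 2 + s * b ^+ 2 - ((1 - s) * a + s * b) ^+ 2 =
    s * (1 - s) * (a - b) ^+ 2 by ring.
  by rewrite mulr_ge0 ?sqr_ge0 // mulr_ge0 // subr_ge0.
move=> /le_trans; apply; rewrite big_split /= -!mulr_sumr.
apply: (@le_trans _ _ ((1 - s) * 1 + s * 1)); last by rewrite !mulr1 subrK.
by rewrite lerD // ler_wpM2l ?subr_ge0.
Qed.

Lemma closed_ball0_compact : compact (closed_ball0 1 : set 'rV[R]_d).
Proof.
apply: bounded_closed_compact.
  exists 1; split; first exact: num_real.
  move=> M M1 x /(closed_ball0_norm ler01) x1; exact: le_trans (ltW M1).
rewrite (_ : closed_ball0 1 =
    (fun x => \sum_i x ord0 i ^+ 2) @^-1` [set y | y <= 1 ^+ 2]); last first.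
  by apply/seteqP; split => x h; apply/(closed_ball0P _ ler01).
apply: closed_comp; last exact: closed_le.
move=> x _; apply: (continuous_big (@add_continuous R^o)) => i _ y.
apply: (@continuous_comp _ _ _ (fun M : 'rV[R]_d => M ord0 i) (fun z : R => z ^+ 2)).
  exact: coord_continuous.
exact: exprn_continuous.
Qed.

Lemma star_connected A :
  (forall x t, A x -> 0 <= t <= 1 -> A (t *: x)) -> connected A.
Proof.
move=> star.
have -> : A = \bigcup_(x in A) ((fun t : R => t *: x) @` `[0, 1]).
  apply/seteqP; split => [x Ax|x [y Ay [t]]].
    by exists x => //; exists 1; rewrite ?scale1r //= in_itv /= lexx ler01.
  by rewrite /= in_itv /= => t01 <-; exact: star.
apply: bigcup_connected.
  by exists 0 => x Ax; exists 0; rewrite ?scale0r //= in_itv /= lexx ler01.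
move=> x _; apply: connected_continuous_connected; first exact: segment_connected.
apply: continuous_subspaceT => t; exact: scalel_continuous.
Qed.

Lemma closed_ball0_connected : connected (closed_ball0 1 : set 'rV[R]_d).
Proof.
apply: star_connected => x t /(closed_ball0P _ ler01) h /andP[t0 t1].
apply/(closed_ball0P _ ler01); apply: le_trans h; apply: ler_sum => i _.
by rewrite mxE exprMn ler_piMl ?sqr_ge0 // expr_le1.
Qed.

Lemma disk_nonempty A : closed_disk A -> A !=set0.
Proof.
move=> [h [k [_ _ <- _ _]]]; exists (h 0), 0 => //.
by apply: norm_closed_ball0 => //; rewrite normr0 mulr0.
Qed.

Lemma disk_connected A : closed_disk A -> connected A.
Proof.
move=> [h [k [hc _ <- _ _]]].
exact: connected_continuous_connected closed_ball0_connected hc.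
Qed.

Lemma disk_bounded A : closed_disk A -> exists M : R, forall x, A x -> `|x| <= M.
Proof.
move=> [h [k [hc _ <- _ _]]].
have [M [_ hM]] := compact_bounded (continuous_compact hc closed_ball0_compact).
by exists (M + 1) => x hx; apply: hM => //; rewrite ltrDl.
Qed.

(** A shrunken cube inside the unit ball, placed close to the preimage of a point,
    is embedded by the chart, so its image has an interior point close to the given
    one. *)
Lemma disk_interior_dense A x (e : R) : closed_disk A -> A x -> 0 < e ->
  exists2 y, A° y & `|y - x| < e.
Proof.
move=> [h [k [hc _ <- hk _]]] [p bp <-] e0.
have [del del0 hd] := (within_continuous_epsP _ _).1 hc p bp e e0.
pose s : R := Num.min 1 (del / 4).
have s0 : 0 < s by rewrite lt_min ltr01 divr_gt0.
have s1 : s <= 1 by rewrite ge_min lexx.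
have s4 : s <= del / 4 by rewrite ge_min lexx orbT.
have d1 : (0 : R) < d.+1%:R by rewrite ltr0n.
(* The factor 1/(d+1) puts the unit cube inside the Euclidean ball. *)
pose q w : 'rV[R]_d := (1 - s) *: p + s *: (d.+1%:R^-1 *: w).
have small (w : 'rV[R]_d) : unit_cube w -> `|d.+1%:R^-1 *: w| <= d.+1%:R^-1.
  move=> cw; apply: row_norm_le => [|i]; first by rewrite invr_ge0.
  rewrite mxE; have /andP[w0 w1] := cw i.
  by rewrite ger0_norm ?mulr_ge0 ?invr_ge0 // ler_piMr // invr_ge0.
have ball_q w : unit_cube w -> closed_ball0 1 (q w).
  move=> cw; apply: closed_ball0_convex => //; first by rewrite (ltW s0).
  apply: norm_closed_ball0 => //; apply: (@le_trans _ _ (d%:R * d.+1%:R^-1)).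
    by rewrite ler_wpM2l // small.
  by rewrite ler_pdivrMr // mul1r ler_nat.
have qp w : unit_cube w -> `|q w - p| < del.
  move=> cw; have -> : q w - p = s *: (d.+1%:R^-1 *: w - p).
    by apply/rowP => i; rewrite !mxE; ring.
  rewrite normrZ gtr0_norm //.
  have p1 := closed_ball0_norm ler01 bp.
  have w1 : `|d.+1%:R^-1 *: w| <= 1.
    by apply: le_trans (small w cw) _; rewrite invf_le1 // ler1n.
  have : `|d.+1%:R^-1 *: w - p| <= 2.
    by apply: le_trans (ler_normB _ _) _; rewrite -[2]/(1 + 1) lerD.
  move=> /(ler_wpM2l (ltW s0)) /le_lt_trans; apply.
  by apply: (@le_lt_trans _ _ (del / 4 * 2)); [rewrite ler_wpM2r|lra].
have q_diff v w : q v - q w = (s / d.+1%:R) *: (v - w).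
  by rewrite /q opprD addrACA subrr add0r -scalerBr -scalerBr scalerA.
have [y iy] : ((h \o q) @` unit_cube)° !=set0.
  apply: cube_embedding_interior.
    apply/within_continuous_epsP => w cw e' e'0.
    have [del' del'0 hd'] := (within_continuous_epsP _ _).1 hc (q w) (ball_q w cw) e' e'0.
    exists del' => // v cv vw; apply: hd'; first exact: ball_q.
    rewrite q_diff normrZ; apply: le_lt_trans vw; rewrite ler_piMl //.
    rewrite ger0_norm ?divr_ge0 ?(ltW s0) // ler_pdivrMr // mul1r.
    by apply: le_trans s1 _; rewrite ler1n.
  move=> v w cv cw /= hvw.
  have : q v = q w.
    by rewrite -(hk _ (mem_set (ball_q v cv))) hvw hk //; exact/mem_set/ball_q.
  move/eqP; rewrite -subr_eq0 q_diff scaler_eq0 => /orP[|].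
    by rewrite gt_eqF // divr_gt0.
  by rewrite subr_eq0 => /eqP.
exists y.
  apply: interiorS iy => _ [w cw <-] /=; exists (q w) => //; exact: ball_q.
have [w cw <-] := interior_subset iy.
by apply: hd; [exact: ball_q|exact: qp].
Qed.

Lemma mapply_diff g x y : mapply g x - mapply g y = (x - y) *m g.1.
Proof. by rewrite /mapply opprD addrACA subrr addr0 mulmxBl. Qed.

(** An entry of an orthogonal matrix is at most 1 in absolute value. *)
Lemma mapply_lipschitz g x y : euclidean_group R d g ->
  `|mapply g x - mapply g y| <= d%:R * `|x - y|.
Proof.
move=> gE; rewrite mapply_diff; set z := x - y.
have entry i j : `|g.1 i j| <= 1.
  have : (g.1 *m g.1^T) i i = 1 by rewrite gE mxE eqxx.
  rewrite mxE (bigD1 j) //= mxE -expr2 => e.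
  rewrite -(ler_pXn2r (_ : 0 < 2)%N) ?nnegrE // -normrX ger0_norm ?sqr_ge0 // expr1n.
  rewrite -[leRHS]e lerDl; apply: sumr_ge0 => k _.
  by rewrite mxE -expr2 sqr_ge0.
apply: row_norm_le => [|j]; first by rewrite mulr_ge0.
rewrite mxE (le_trans (ler_norm_sum _ _ _)) //.
have : \sum_(i < d) `|z ord0 i * g.1 i j| <= \sum_(i < d) `|z|.
  apply: ler_sum => i _; rewrite normrM -[leRHS]mulr1.
  by rewrite ler_pM //; exact: le_row_norm.
by move=> /le_trans; apply; rewrite sumr_const card_ord mulr_natl.
Qed.

Lemma minv_euclidean g : euclidean_group R d g -> euclidean_group R d (minv g).
Proof. by move=> gE; rewrite /euclidean_group /= trmxK; exact: mulmx1C. Qed.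

Lemma minvK g : euclidean_group R d g -> minv (minv g) = g.
Proof.
move=> gE; case: g gE => M v /= gE; rewrite /minv /= trmxK; congr (_, _).
by rewrite mulNmx opprK -mulmxA (mulmx1C gE) mulmx1.
Qed.

Lemma mapply_invr g x : euclidean_group R d g -> mapply g (mapply (minv g) x) = x.
Proof. by move=> gE; rewrite -{1}(minvK gE) mapply_inv //; exact: minv_euclidean. Qed.

Lemma mapply_small g x y (e : R) : euclidean_group R d g -> 0 < e ->
  `|x - y| < e / d.+1%:R -> `|mapply g x - mapply g y| < e.
Proof.
move=> gE e0 xy; apply: le_lt_trans (mapply_lipschitz x y gE) _.
apply: (@le_lt_trans _ _ (d.+1%:R * `|x - y|)).
  by rewrite ler_wpM2r // ler_nat.
by rewrite mulrC -ltr_pdivlMr // ltr0n.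
Qed.

Lemma disk_image g A : euclidean_group R d g -> closed_disk A ->
  closed_disk (mapply g @` A).
Proof.
move=> gE [h [k [hc kc hA hk kh]]].
have d1 : (0 : R) < d.+1%:R by rewrite ltr0n.
exists (mapply g \o h), (k \o mapply (minv g)); split.
- apply/within_continuous_epsP => x bx e e0.
  have ed : 0 < e / d.+1%:R by rewrite divr_gt0.
  have [del del0 hd] := (within_continuous_epsP _ _).1 hc x bx _ ed.
  by exists del => // y yb yx; apply: mapply_small => //; exact: hd.
- apply/within_continuous_epsP => _ [x Ax <-] e e0.
  have [del del0 hd] := (within_continuous_epsP _ _).1 kc x Ax _ e0.
  exists (del / d.+1%:R); first by rewrite divr_gt0.
  move=> _ [y Ay <-] /= yx; rewrite !mapply_inv //; apply: hd => //.
  rewrite -(mapply_inv y gE) -(mapply_inv x gE).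
  by apply: mapply_small => //; exact: minv_euclidean.
- by rewrite -hA image_comp.
- by move=> x bx /=; rewrite mapply_inv // hk.
- by move=> _ /set_mem[x Ax <-] /=; rewrite mapply_inv // kh //; exact: mem_set.
Qed.
End Disks.

(** * Tiles, patches and supertiles *)

Section Action.
Context {R : realType} {d : nat} {L : Type}.
Implicit Types (g h : motion R d) (t u : tile R d L) (P Q T : set (tile R d L)).

Lemma tact_mul g h t : tact (mmul g h) t = tact g (tact h t).
Proof.
rewrite /tact /= image_comp; congr (_, _).
by apply: eq_imagel => x _; exact: mapply_mul.
Qed.

Lemma tact_id t : tact (mid d) t = t.
Proof.
case: t => A l; rewrite /tact /=; congr (_, _); rewrite -[RHS]image_id.
by apply: eq_imagel => x _; exact: mapply_id.
Qed.

Lemma tactK g t : euclidean_group R d g -> tact (minv g) (tact g t) = t.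
Proof.
move=> gE; case: t => A l; rewrite /tact /= image_comp; congr (_, _).
by rewrite -[RHS]image_id; apply: eq_imagel => x _; exact: mapply_inv.
Qed.

Lemma pact_mul g h P : pact (mmul g h) P = pact g (pact h P).
Proof. by rewrite /pact image_comp; apply: eq_imagel => t _; exact: tact_mul. Qed.

Lemma pact_id P : pact (mid d) P = P.
Proof. by rewrite -[RHS]image_id; apply: eq_imagel => t _; exact: tact_id. Qed.

Lemma pact_sub g P Q : P `<=` Q -> pact g P `<=` pact g Q.
Proof. by move=> PQ _ [t Pt <-]; exists t => //; exact: PQ. Qed.

Lemma pact_subV g P Q : euclidean_group R d g ->
  P `<=` pact g Q -> pact (minv g) P `<=` Q.
Proof. by move=> gE PQ _ [_ /PQ[t Qt <-] <-]; rewrite tactK. Qed.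

Lemma support_pact g P : support (pact g P) = mapply g @` support P.
Proof.
apply/seteqP; split => [x [_ [t Pt <-] [y ty <-]]|_ [y [t Pt ty] <-]].
  by exists y => //; exists t.
by exists (tact g t); [exists t|exists y].
Qed.

Lemma non_overlapping_sub P Q : P `<=` Q -> non_overlapping Q -> non_overlapping P.
Proof. by move=> PQ Qno t u Pt Pu; apply: Qno; exact: PQ. Qed.

(** The interior of a tile is disjoint from its boundary, hence from every other tile
    of a non-overlapping family. *)
Lemma interior_tile_unique T t u x : non_overlapping T -> T t -> T u ->
  t.1° x -> u.1 x -> t = u.
Proof.
move=> Tno Tt Tu tx ux; apply: contrapT => tu.
have [|[_ +] _] := Tno _ _ Tt Tu tu x; last exact.
by split=> //; exact: interior_subset tx.
Qed.
End Action.

Section Tiles.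
Context {R : realType} {d : nat} {L : Type} {G : set (motion R d)}.
Context (Ggroup : euclidean_subgroup G) (F : fusion_rule L G).
Implicit Types (g h : motion R d) (t u : tile R d L) (P Q T U : set (tile R d L)).

Let GE g : G g -> euclidean_group R d g.
Proof. by case: Ggroup => + _ _ _; exact. Qed.
Let G1 : G (mid d). Proof. by case: Ggroup. Qed.
Let GM g h : G g -> G h -> G (mmul g h).
Proof. by case: Ggroup => _ _ + _; exact. Qed.
Let GV g : G g -> G (minv g).
Proof. by case: Ggroup => _ _ _; exact. Qed.

Local Notation tiles := (is_tile G (@prototile R d L G F)).
Local Notation is_patch := (patch G (@prototile R d L G F)).
Local Notation is_tiling := (tiling G (@prototile R d L G F)).
Local Notation ball_tiles T rho := (tiles_meeting T [set x : 'rV[R]_d | `|x| <= rho]).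

Lemma is_tile_tact g t : G g -> tiles t -> tiles (tact g t).
Proof.
by move=> Gg [i [h Gh ->]]; exists i, (mmul g h); [exact: GM|rewrite tact_mul].
Qed.

Lemma tile_disk t : tiles t -> closed_disk t.1.
Proof. by move=> [i [g /GE Gg ->]]; apply: disk_image => //; exact: prototile_disk. Qed.

Lemma tile_interior_point t : tiles t -> exists x, t.1° x.
Proof.
move=> /tile_disk dt; have [x tx] := disk_nonempty dt.
by have [y ty _] := disk_interior_dense dt tx ltr01; exists y.
Qed.

Lemma tile_inner_ball : exists2 r : R, 0 < r &
  forall t, tiles t -> exists c, forall y, `|y - c| < r -> t.1 y.
Proof.
have d1 : (0 : R) < d.+1%:R by rewrite ltr0n.
have [r r0 hr] : exists2 r : R, 0 < r & forall i, exists c, forall y,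
    `|y - c| < r -> (@prototile R d L G F i).1 y.
  apply: (@finite_pos_lower_bound R _ (fun i r => exists c, forall y,
    `|y - c| < r -> (@prototile R d L G F i).1 y)).
    by move=> i r r' _ rr [c hc]; exists c => y yc; apply: hc; exact: lt_le_trans rr.
  move=> i; have dt := prototile_disk i; have [x tx] := disk_nonempty dt.
  have [c /nbhs_row[r r0 hr] _] := disk_interior_dense dt tx ltr01.
  by exists r => //; exists c.
exists (r / d.+1%:R) => [|_ [i [g /GE gE ->]]]; first exact: divr_gt0.
have [c hc] := hr i; exists (mapply g c) => y yc.
exists (mapply (minv g) y); last exact: mapply_invr.
apply: hc; rewrite -(mapply_inv c gE).
by apply: mapply_small => //; exact: minv_euclidean.
Qed.

Lemma patch_bounded P : finite_set P -> P `<=` tiles ->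
  exists2 M : R, 0 < M & forall x, support P x -> `|x| <= M.
Proof.
move=> finP Pt.
have [|t /Pt/tile_disk/disk_bounded//|M M0 hM] := finite_upper_bound (R := R)
    (P := fun t M => forall x, t.1 x -> `|x| <= M) finP.
  by move=> t e e' ee h x tx; exact: le_trans (h x tx) ee.
by exists M => // x [t /hM]; exact.
Qed.

Lemma supertile_diameter n : exists2 D : R, 0 < D &
  forall (i : 'I_(num F n)) g x y, G g -> support (pact g (supertile i)) x ->
    support (pact g (supertile i)) y -> `|x - y| <= D.
Proof.
have [||D D0 hD] := @finite_upper_bound R 'I_(num F n) setT
   (fun i D => forall g x y, G g -> support (pact g (supertile i)) x ->
    support (pact g (supertile i)) y -> `|x - y| <= D) finite_finset.
- by move=> i D D' DD h g x y Gg sx sy; exact: le_trans (h g x y Gg sx sy) DD.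
- move=> i _; have [fi _ ti _ _] := supertile_patch i.
  have [M M0 hM] := patch_bounded fi ti.
  exists (d%:R * (M + M)) => g x y /GE gE; rewrite support_pact.
  move=> [x' sx <-] [y' sy <-]; apply: le_trans (mapply_lipschitz _ _ gE) _.
  rewrite ler_wpM2l //; apply: le_trans (ler_normB _ _) _.
  by rewrite lerD // hM.
- by exists D => // i; exact: hD.
Qed.

Lemma tile_diameter : exists2 D : R, 0 < D &
  forall t x y, tiles t -> t.1 x -> t.1 y -> `|x - y| <= D.
Proof.
have [D D0 hD] := supertile_diameter 0; exists D => // t x y [i [g Gg ->]] tx ty.
apply: (hD i g) => //; exists (tact g (prototile i)) => //;
  by exists (prototile i) => //; rewrite supertile0.
Qed.

(** Every tile contains a ball of a fixed radius, hence a point of a fixed lattice in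
    its interior, and distinct tiles contain distinct lattice points. *)
Lemma locally_finite T rho : T `<=` tiles -> non_overlapping T ->
  finite_set (ball_tiles T rho).
Proof.
move=> Tt Tno.
have [r r0 hr] := tile_inner_ball; have [D D0 hD] := tile_diameter.
pose K := Num.bound ((`|rho| + D + r) / r).
have hK : `|rho| + D + r < r * K%:R.
  rewrite mulrC -ltr_pdivrMr //; apply: archi_boundP.
  by rewrite divr_ge0 ?(ltW r0) // !addr_ge0 ?(ltW r0) ?(ltW D0).
pose point (z : {ffun 'I_d -> 'I_(2 * K).+1}) : 'rV[R]_d :=
  \row_j (r * ((z j)%:R - K%:R)).
apply: (@sub_finite_set _ _
  (\bigcup_(z in [set: {ffun 'I_d -> 'I_(2 * K).+1}])
     [set t | T t /\ t.1° (point z)])).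
  move=> t [Tt' [x [tx /= xrho]]].
  have [c hc] := hr t (Tt _ Tt').
  have tc : t.1 c by apply: hc; rewrite subrr normr0.
  have cb : `|c| <= `|rho| + D.
    rewrite -(subrK x c) (le_trans (ler_normD _ _)) // addrC lerD //.
      by apply: le_trans xrho _; exact: ler_norm.
    exact: hD (Tt _ Tt') tc tx.
  pose f j := Num.floor (c ord0 j / r).
  have fz j : exists z : 'I_(2 * K).+1, (z : nat)%:Z = f j + K%:Z.
    have cj : `|c ord0 j| <= `|rho| + D := le_trans (le_row_norm _ _) cb.
    have /andP[f1 f2] := floor_itv (c ord0 j / r).
    move: cj; rewrite ler_norml => /andP[c1 c2].
    have g1 : - K%:Z < f j + 1.
      rewrite -(ltr_int R) rmorphN /=; apply: le_lt_trans f2.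
      by rewrite ler_pdivlMr // mulrC mulrN; lra.
    have g2 : f j < K%:Z.
      rewrite -(ltr_int R); apply: le_lt_trans f1 _.
      by rewrite ltr_pdivrMr // mulrC /=; lra.
    have lt : (absz (f j + K%:Z)%R < (2 * K).+1)%N by lia.
    by exists (Ordinal lt); rewrite /=; lia.
  have [z hz] := choice fz.
  exists [ffun j => z j] => //; split => //.
  have pc : `|point [ffun j => z j] - c| < r.
    apply: row_norm_lt => // j; rewrite !mxE ffunE.
    have -> : (z j)%:R - K%:R = (f j)%:~R :> R.
      by rewrite -[(z j)%:R]/((z j)%:Z%:~R) hz intrD addrK.
    have /andP[f1 f2] := floor_itv (c ord0 j / r).
    rewrite -/(f j) in f1 f2.
    rewrite ler_pdivlMr // in f1; rewrite ltr_pdivrMr // intrD mulrDl mul1r in f2.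
    by rewrite ltr_norml mulrC; apply/andP; split; lra.
  apply/nbhs_row; exists (r - `|point [ffun j => z j] - c|).
    by rewrite subr_gt0.
  move=> y yp; apply: hc; rewrite -(subrK (point [ffun j => z j]) y) -addrA.
  by rewrite (le_lt_trans (ler_normD _ _)) // -ltrBrDr.
apply: bigcup_finite => [|z _]; first exact: finite_finset.
have [[t [Tt' tz]]|none] := pselect (exists t, T t /\ t.1° (point z)).
  apply: (sub_finite_set _ (finite_set1 t)) => u [Tu uz] /=.
  by apply: (interior_tile_unique Tno Tu Tt' uz); exact: interior_subset tz.
by apply: (sub_finite_set _ (finite_set0 _)) => u hu; apply: none; exists u.
Qed.

Lemma ball_connected (rho : R) : connected [set x : 'rV[R]_d | `|x| <= rho].
Proof.
apply: star_connected => x t /= h /andP[t0 t1].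
by apply: le_trans h; rewrite normrZ ger0_norm // ler_piMl.
Qed.

(** The support is connected since each of the tiles meets the ball, which they cover. *)
Lemma ball_tiles_patch T rho : is_tiling T -> 0 <= rho -> is_patch (ball_tiles T rho).
Proof.
move=> [Tt Tcov Tno] rho0.
have cov x : exists2 t, T t & t.1 x.
  by have : support T x by rewrite Tcov.
have B0 : [set x : 'rV[R]_d | `|x| <= rho] 0 by rewrite /= normr0.
split.
- exact: locally_finite.
- by have [t Tt' t0] := cov 0; exists t; split => //; exists 0.
- by move=> t [/Tt].
- by apply: non_overlapping_sub Tno => t [].
set B := [set x : 'rV[R]_d | `|x| <= rho].
have -> : support (ball_tiles T rho) = \bigcup_(t in ball_tiles T rho) (B `|` t.1).
  apply/seteqP; split => x [t Pt]; first by exists t => //; right.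
  move=> [Bx|tx]; last by exists t.
  by have [u Tu ux] := cov x; exists u => //; split => //; exists x.
apply: bigcup_connected; first by exists 0 => t _; left.
move=> t [Tt' [x [tx Bx]]]; apply: connectedU; first by exists x.
  exact: ball_connected.
exact/disk_connected/tile_disk/Tt.
Qed.

Lemma patch_pact g P : G g -> is_patch P -> non_overlapping (pact g P) ->
  is_patch (pact g P).
Proof.
move=> Gg [Pfin [t Pt] Ptiles _ Pconn] Pno; split => //.
- exact: finite_image.
- by exists (tact g t), t.
- by move=> _ [u Pu <-]; apply: is_tile_tact => //; exact: Ptiles.
rewrite support_pact; apply: connected_continuous_connected => //.
apply/within_continuous_epsP => x _ e e0; exists (e / d.+1%:R).
  by rewrite divr_gt0.
by move=> y _; apply: mapply_small => //; exact: GE.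
Qed.

Lemma pieces_group m n (i : 'I_(num F (m + n))) c : pieces i c -> G c.1.
Proof.
elim: m i c => [i c ->//|m IH i c [a _ [c' /IH Gc' <-]]] /=.
by apply: GM => //; exact: dec_group.
Qed.

Lemma pieces_cover m n (i : 'I_(num F (m + n))) :
  supertile i = \bigcup_(c in pieces i) pact c.1 (supertile c.2).
Proof.
elim: m i => [|m IH] i.
  by rewrite /= bigcup_set1 /= pact_id.
rewrite [LHS](@dec_cover R d L G F (m + n) i) /= bigcup_bigcup.
apply: eq_bigcupr => a _; rewrite bigcup_image /= [X in pact _ X]IH.
rewrite /pact image_bigcup; apply: eq_bigcupr => c _.
by rewrite -/(pact _ _) -/(pact _ _) -/(pact _ _) pact_mul.
Qed.
End Tiles.

(** * Minimality *)

Section Minimality.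
Context {R : realType} {d : nat} {L : Type} {G : set (motion R d)}.
Context (Ggroup : euclidean_subgroup G) (F : fusion_rule L G).
Implicit Types (g h : motion R d) (t u : tile R d L) (P Q T U : set (tile R d L)).

Let GE g : G g -> euclidean_group R d g.
Proof. by case: Ggroup => + _ _ _; exact. Qed.
Let G1 : G (mid d). Proof. by case: Ggroup. Qed.
Let GM g h : G g -> G h -> G (mmul g h).
Proof. by case: Ggroup => _ _ + _; exact. Qed.
Let GV g : G g -> G (minv g).
Proof. by case: Ggroup => _ _ _; exact. Qed.

Local Notation tiles := (is_tile G (@prototile R d L G F)).
Local Notation is_patch := (patch G (@prototile R d L G F)).
Local Notation is_tiling := (tiling G (@prototile R d L G F)).
Local Notation ball_tiles T rho := (tiles_meeting T [set x : 'rV[R]_d | `|x| <= rho]).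

Lemma admitted_pact g P : G g -> admitted F (pact g P) -> admitted F P.
Proof.
move=> Gg [n [i [h Gh hP]]]; exists n, i, (mmul h g); first exact: GM.
by rewrite pact_mul.
Qed.

(** The tiles of T that meet a large ball form a patch too wide to fit into a
    supertile of level below M; inside the higher supertile that contains it, the
    level-M piece through the image of the centre is so small that the patch
    contains it. *)
Lemma tiling_contains_supertile T M : (0 < d)%N -> tiling_space F T ->
  exists (j : 'I_(num F M)), exists2 g, G g & pact g (supertile j) `<=` T.
Proof.
move=> d0 [Ttil Tadm]; have [Ttiles Tcov Tno] := Ttil.
have [D D0 hD] : exists2 D : R, 0 < D & forall n, (n <= M)%N ->
    forall (i : 'I_(num F n)) g x y, G g -> support (pact g (supertile i)) x ->
    support (pact g (supertile i)) y -> `|x - y| <= D.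
  have [||D D0 hD] := @finite_upper_bound R 'I_M.+1 setT (fun n D =>
      forall (i : 'I_(num F n)) g x y, G g -> support (pact g (supertile i)) x ->
      support (pact g (supertile i)) y -> `|x - y| <= D) finite_finset.
  - by move=> n e e' ee h i g x y Gg sx sy; exact: le_trans (h i g x y Gg sx sy) ee.
  - by move=> n _; have [D _ hD] := supertile_diameter Ggroup F n; exists D.
  by exists D => // n nM; exact: (hD (Ordinal (nM : n < M.+1)%N) I).
pose rho := d.+1%:R * D.
have rho0 : 0 <= rho by rewrite mulr_ge0 // ltW.
have Drho : d%:R * D < rho by rewrite ltr_pM2r // ltr_nat.
have Qpatch := ball_tiles_patch Ggroup Ttil rho0.
set Q := ball_tiles T rho in Qpatch.
have QT : Q `<=` T by move=> t [].
have Qcov x : `|x| <= rho -> support Q x.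
  move=> xr; have [t Tt tx] : support T x by rewrite Tcov.
  by exists t => //; split => //; exists x.
have [N [i [g Gg gQ]]] := Tadm Q Qpatch QT.
have gE := GE Gg.
have sup x : `|x| <= rho -> support (supertile i) (mapply g x).
  move=> /Qcov[t Qt tx]; exists (tact g t); first by apply: gQ; exists t.
  by exists x.
have norm0 : `|0 : 'rV[R]_d| <= rho by rewrite normr0.
(* The point far has norm rho, and motions distort the sup norm by a factor d at most. *)
have MN : (M <= N)%N.
  rewrite leqNgt; apply/negP => NM.
  pose far : 'rV[R]_d := const_mx rho.
  have normfar : `|far| <= rho.
    by apply: row_norm_le => // j; rewrite mxE ger0_norm.
  have : rho <= `|far - 0|.
    rewrite subr0 -[leLHS](ger0_norm rho0).
    by have := le_row_norm far (Ordinal d0); rewrite mxE.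
  rewrite leNgt => /negP; apply; apply: le_lt_trans Drho.
  rewrite -(mapply_inv far gE) -(mapply_inv 0 gE).
  apply: le_trans (mapply_lipschitz _ _ (minv_euclidean gE)) _.
  rewrite ler_wpM2l //; apply: (hD N (ltnW NM) i (mid d)) => //;
    by rewrite pact_id; exact: sup.
move: i gQ sup; rewrite -(subnK MN) => i gQ sup.
have [t Qt t0] := Qcov _ norm0.
have : supertile i (tact g t) by apply: gQ; exists t.
rewrite pieces_cover => -[c ic ct].
have Gc := pieces_group Ggroup ic.
have [_ _ itiles ino _] := supertile_patch i.
have piece_sub : pact c.1 (supertile c.2) `<=` supertile i.
  by move=> u cu; rewrite pieces_cover; exists c.
exists c.2, (mmul (minv g) c.1); first by apply: GM => //; exact: GV.
rewrite pact_mul; apply: subset_trans QT; apply: pact_subV => // u cu.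
have iu := piece_sub _ cu.
have [y uy] := tile_interior_point Ggroup (itiles _ iu).
have close : `|mapply (minv g) y| <= rho.
  rewrite -[X in `|X|]subr0 -{1}(mapply_inv 0 gE).
  apply: le_trans (mapply_lipschitz _ _ (minv_euclidean gE)) (le_trans _ (ltW Drho)).
  rewrite ler_wpM2l //; apply: (hD M (leqnn M) c.2 c.1) => //.
    by exists u => //; exact: interior_subset uy.
  by exists (tact g t) => //; exists 0.
have [s Qs sy] := Qcov _ close.
exists s => //; apply/esym; apply: (interior_tile_unique ino iu _ uy).
  by apply: gQ; exists s.
by exists (mapply (minv g) y) => //; exact: mapply_invr.
Qed.

(** This is where primitivity enters. *)
Lemma tiling_contains_patch T U P : (0 < d)%N -> primitive F ->
  tiling_space F T -> tiling_space F U -> is_patch P -> P `<=` U ->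
  exists2 h, G h & pact h P `<=` T.
Proof.
move=> d0 Fprim XT [_ Uadm] Ppatch PU.
have [n [i [g Gg gP]]] := Uadm P Ppatch PU.
have [m hm] := Fprim n.
have [j [h Gh hj]] := tiling_contains_supertile (m + n) d0 XT.
have [c jc [k Gk kc]] := hm j i.
exists (mmul h (mmul k g)); first by do 2?apply: GM.
rewrite !pact_mul; apply: subset_trans hj; apply: pact_sub.
apply: (@subset_trans _ (pact k (supertile i))); first exact: pact_sub.
by rewrite -kc => u cu; rewrite pieces_cover; exists c.
Qed.

(** Mark a point in each tile of the patch: as soon as the ball of agreement contains the
    marked points, the patch occurs in a moved copy of T. *)
Lemma orbit_closure_sub T : tiling_space F T -> orbit_closure F T `<=` tiling_space F.
Proof.
move=> [[_ _ Tno] Tadm] U [Util hU]; split => // P Ppatch PU.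
have [Pfin _ Ptiles _ _] := Ppatch.
have [||M M0 hM] := @finite_upper_bound R _ P
    (fun t M => exists2 x, t.1 x & `|x| <= M) Pfin.
- by move=> t e e' ee [x tx xe]; exists x => //; exact: le_trans ee.
- move=> t Pt; have [x tx] := disk_nonempty (tile_disk Ggroup (Ptiles _ Pt)).
  by exists `|x|, x.
(* The radius 1/e exceeds the norm of every displaced marked point. *)
pose rad : R := 1 + d%:R * (d%:R * M + 1).
have rad1 : 1 <= rad.
  by rewrite lerDl mulr_ge0 // addr_ge0 // mulr_ge0 // ltW.
have rad0 : 0 < rad := lt_le_trans ltr01 rad1.
have [|g Gg [a [b [Ga Gb _ bsize agree]]]] := hU rad^-1; first by rewrite invr_gt0.
rewrite invrK in agree.
have [aE bE gE] := And3 (GE Ga) (GE Gb) (GE Gg).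
have b0 : `|mapply b 0| <= 1.
  rewrite /mapply mul0mx add0r; apply: (@closed_ball0_norm _ _ 1) => //.
  move: bsize; rewrite /msize ge_max => /andP[_ h].
  by apply: le_trans h _; rewrite invf_le1.
have inT : pact b P `<=` pact a (pact g T).
  move=> _ [t Pt <-]; have [x tx xM] := hM t Pt.
  have : tiles_meeting (pact b U) (closed_ball0 rad) (tact b t).
    split; first by exists t => //; exact: PU.
    exists (mapply b x); split; first by exists x.
    apply: norm_closed_ball0; first exact: ltW.
    apply: (@le_trans _ _ (d%:R * (d%:R * M + 1))); last by rewrite lerDr.
    rewrite ler_wpM2l // -(subrK (mapply b 0) (mapply b x)).
    apply: le_trans (ler_normD _ _) _; rewrite lerD //.
    apply: le_trans (mapply_lipschitz _ _ bE) _.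
    by rewrite subr0 ler_wpM2l.
  by rewrite -agree => -[].
pose w := mmul (minv g) (mmul (minv a) b).
have Gw : G w by apply: GM; [exact: GV|apply: GM => //; exact: GV].
have wP : pact w P `<=` T.
  by rewrite !pact_mul; apply: pact_subV => //; exact: pact_subV.
apply: (admitted_pact Gw); apply: Tadm => //; apply: patch_pact => //.
exact: non_overlapping_sub Tno.
Qed.

(** A motion of T contains all tiles of U that meet the ball of radius 1/e + 1. A tile of
    the moved T that meets the ball of radius 1/e has an interior point in the larger
    ball, which U covers by one of these tiles, so it is that tile. *)
Lemma sub_orbit_closure T : (0 < d)%N -> primitive F ->
  tiling_space F T -> tiling_space F `<=` orbit_closure F T.
Proof.
move=> d0 Fprim XT U XU; have [Util _] := XU; split => // e e0.
have [Utiles Ucov Uno] := Util; have [[Ttiles _ Tno] _] := XT.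
pose rho := e^-1 + 1.
have e'0 : 0 < e^-1 by rewrite invr_gt0.
have rho0 : 0 <= rho by rewrite addr_ge0 // ltW.
have [|h Gh hP] := tiling_contains_patch d0 Fprim XT XU
  (ball_tiles_patch Ggroup Util rho0); first by move=> t [].
have hE := GE Gh.
exists (minv h); first exact: GV.
have size1 : msize (mid d : motion R d) <= e.
  suff -> : msize (mid d : motion R d) = 0 by exact: ltW.
  rewrite /msize subrr /eucl_norm !big1 ?sqrtr0 ?maxxx // => i _;
    by rewrite big1 // => j _; rewrite mxE expr0n.
exists (mid d), (mid d); split => //; rewrite !pact_id /agree_on.
have ball_rho (x : 'rV[R]_d) : closed_ball0 e^-1 x -> `|x| <= e^-1.
  by apply: closed_ball0_norm; exact: ltW.
apply/seteqP; split => t [].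
  move=> [u Tu <-] meets; split => //.
  have [_ [[x ux <-] bx]] := meets.
  have d1 : (0 : R) < 1 / d.+1%:R by rewrite divr_gt0.
  have [y uy yx] := disk_interior_dense (tile_disk Ggroup (Ttiles _ Tu)) ux d1.
  have yrho : `|mapply (minv h) y| <= rho.
    rewrite -(subrK (mapply (minv h) x) (mapply (minv h) y)) /rho addrC.
    apply: le_trans (ler_normD _ _) _; rewrite lerD ?ball_rho // ltW //.
    by apply: mapply_small => //; exact: minv_euclidean.
  have [s Us sy] : support U (mapply (minv h) y) by rewrite Ucov.
  suff -> : u = tact h s by rewrite tactK.
  apply: (interior_tile_unique Tno Tu _ uy).
    by apply: hP; exists s => //; split => //; exists (mapply (minv h) y).
  by exists (mapply (minv h) y) => //; exact: mapply_invr.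
move=> Ut [x [tx bx]]; split; last by exists x.
exists (tact h t); last exact: tactK.
apply: hP; exists t => //; split => //; exists x; split => //=.
by apply: le_trans (ball_rho _ bx) _; rewrite lerDl.
Qed.
End Minimality.

Theorem proposition3p2 (R : realType) (d : nat) (d_gt0 : (0 < d)%N) (L : Type)
    (G : set (motion R d)) (hG : admissible_group G) (F : fusion_rule L G)
    (X_neq0 : tiling_space F !=set0) (X_flc : finite_local_complexity F)
    (F_prim : primitive F) :
  minimal F.
Proof.
have [Ggroup _ _] := hG.
move=> T XT; apply/seteqP; split; first exact: orbit_closure_sub.
exact: sub_orbit_closure.
Qed.
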